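(* Let $F\subset\mathbb{R}^d$ be compact and suppose that the non-empty compact set $\hat F\subset[0,1]^d$ is a generalized fast tangent of $F$, given by bi-Lipschitz maps $T_k:\mathbb{R}^d\to\mathbb{R}^d$ with Lipschitz constants $a_k,b_k$ satisfying $\sup_k b_k=\infty$ and $\sup_k b_k/a_k<\infty$. (i) One has $$\underline{\dim}_B\hat F\le \dim_{qA}F.$$ If, in addition, there is some constant $C'$ such that $b_{k+1}\le C'b_k$ for all $k$, then $$\dim_{qA}\hat F\le\dim_{qA}F.$$ (ii) Assume that $\hat F$ contains an interior point of $[0,1]^d$. Then $$\dim_{qL}F\le\overline{\dim}_B\hat F.$$ If, in addition, there is some constant $C'$ such that $b_{k+1}\le C'b_k$ for all $k$ and, furthermore, there is $\theta>0$ such that for any $r\in(0,1]$ and $x\in\hat F$ there is $y\in\hat F$ with $B(y,r\theta)\subset B(x,r)\cap[0,1]^d$, then $$\dim_{qL}F\le\dim_{qL}\hat F.$$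
   Context: $B(x,R)$ denotes the ball with centre $x$ and radius $R$ in $\mathbb{R}^d$. For bounded $A\subseteq\mathbb{R}^d$, $N_r(A)$ is the least number of balls of radius $r$ needed to cover $A$. The upper and lower box dimensions of a bounded set $E$ are $\overline{\dim}_BE=\limsup_{r\to0}\frac{\log N_r(E)}{-\log r}$ and $\underline{\dim}_BE=\liminf_{r\to0}\frac{\log N_r(E)}{-\log r}$. For $0\le\delta<1$ let $\overline{h_E}(\delta)=\inf\{\alpha\ge0:\exists b,c>0$ such that $\max_{x\in E}N_r(E\cap B(x,R))\le c(R/r)^\alpha$ for all $0<r\le R^{1+\delta}\le R\le b\}$ and $\underline{h_E}(\delta)=\sup\{\alpha\ge0:\exists b,c>0$ such that $\min_{x\in E}N_r(E\cap B(x,R))\ge c(R/r)^\alpha$ for all $0<r\le R^{1+\delta}\le R\le b\}$. The quasi-Assouad dimension is $\dim_{qA}E=\lim_{\delta\to0}\overline{h_E}(\delta)$ and the quasi-lower Assouad dimension is $\dim_{qL}E=\lim_{\delta\to0}\underline{h_E}(\delta)$ (limits as $\delta\to0^+$ of monotone functions). The Hausdorff distance between compact sets $X,Y\subset\mathbb{R}^d$ is $\mathrm{dist}_H(X,Y)=\max\{p_H(X,Y),p_H(Y,X)\}$, where $p_H(X,Y)=\sup_{x\in X}\inf_{y\in Y}\|x-y\|$. Let $F\subset\mathbb{R}^d$ and $\hat F\subset[0,1]^d$ be compact. $\hat F$ is a generalized tangent of $F$ if there is a sequence of bi-Lipschitz maps $T_k:\mathbb{R}^d\to\mathbb{R}^d$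 and constants $0<a_k\le b_k$ with $a_k\|x-y\|\le\|T_k(x)-T_k(y)\|\le b_k\|x-y\|$ for all $x,y\in\mathbb{R}^d$, $\sup_kb_k/a_k<\infty$, $\sup_kb_k=\infty$, and $\mathrm{dist}_H(T_k(F)\cap[0,1]^d,\hat F)\to0$ as $k\to\infty$. It is a generalized fast tangent of $F$ (given by the maps $T_k$) if moreover there are constants $C,\epsilon>0$ such that $\mathrm{dist}_H(T_k(F)\cap[0,1]^d,\hat F)\le Cb_k^{-\epsilon}$ for all $k$. *)

(* Defs.v *)
From HB Require Import structures.
From mathcomp Require Import all_boot all_order all_algebra.
From mathcomp Require Import all_classical all_reals all_analysis.

Set Implicit Arguments.
Unset Strict Implicit.
Unset Printing Implicit Defensive.

Import Order.TTheory GRing.Theory Num.Theory.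
Import numFieldNormedType.Exports.

Local Open Scope classical_set_scope.
Local Open Scope ring_scope.

(* MathComp-Analysis; points of R^d are row vectors.  The library norm on
   matrices is the sup norm, so the Euclidean norm and its closed balls are
   defined here; both norms induce the library topology of 'rV[R]_d. *)
Definition enorm (R : realType) (d : nat) (x : 'rV[R]_d) : R :=
  Num.sqrt (\sum_(i < d) x ord0 i ^+ 2).

Definition eball (R : realType) (d : nat) (x : 'rV[R]_d) (r : R) :
    set 'rV[R]_d :=
  [set y | enorm (x - y) <= r].

Definition unit_cube (R : realType) (d : nat) : set 'rV[R]_d :=
  [set x | forall i : 'I_d, 0 <= x ord0 i <= 1].

Definition covered_by (R : realType) (d : nat) (r : R) (A : set 'rV[R]_d)
    (n : nat) : Prop :=
  exists c : 'I_n -> 'rV[R]_d, A `<=` \bigcup_(i in [set: 'I_n]) eball (c i) r.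

(* The least element of the set of admissible n.  The default value 0 is taken
   only when no finite cover exists, hence never for bounded A and r > 0. *)
Definition covering_number (R : realType) (d : nat) (r : R)
    (A : set 'rV[R]_d) : nat :=
  xget 0%N [set n | covered_by r A n /\
                    forall m, covered_by r A m -> (n <= m)%N].

Definition upper_box_dim (R : realType) (d : nat) (E : set 'rV[R]_d) : \bar R :=
  limf_esup (fun r : R => (ln (covering_number r E)%:R / - ln r)%:E) 0^'+.

Definition lower_box_dim (R : realType) (d : nat) (E : set 'rV[R]_d) : \bar R :=
  limf_einf (fun r : R => (ln (covering_number r E)%:R / - ln r)%:E) 0^'+.

Definition upper_h (R : realType) (d : nat) (E : set 'rV[R]_d) (delta : R) :
    \bar R :=
  ereal_inf [set alpha%:E | alpha in [set alpha : R | 0 <= alpha /\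
    exists b c : R, [/\ 0 < b, 0 < c &
      forall r rho : R, 0 < r -> r <= rho `^ (1 + delta) ->
        rho `^ (1 + delta) <= rho -> rho <= b ->
        forall x, E x ->
          (covering_number r (E `&` eball x rho))%:R
            <= c * (rho / r) `^ alpha]]].

Definition lower_h (R : realType) (d : nat) (E : set 'rV[R]_d) (delta : R) :
    \bar R :=
  ereal_sup [set alpha%:E | alpha in [set alpha : R | 0 <= alpha /\
    exists b c : R, [/\ 0 < b, 0 < c &
      forall r rho : R, 0 < r -> r <= rho `^ (1 + delta) ->
        rho `^ (1 + delta) <= rho -> rho <= b ->
        forall x, E x ->
          c * (rho / r) `^ alpha
            <= (covering_number r (E `&` eball x rho))%:R]]].

Definition quasi_assouad_dim (R : realType) (d : nat) (E : set 'rV[R]_d) :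
    \bar R :=
  lim (upper_h E delta @[delta --> (0 : R)^'+]).

Definition quasi_lower_assouad_dim (R : realType) (d : nat)
    (E : set 'rV[R]_d) : \bar R :=
  lim (lower_h E delta @[delta --> (0 : R)^'+]).

(* Extended-real valued, so that the distance between an empty and a nonempty
   set is +oo: with real-valued inf and sup it would collapse to 0. *)
Definition p_H (R : realType) (d : nat) (X Y : set 'rV[R]_d) : \bar R :=
  ereal_sup [set ereal_inf [set (enorm (x - y))%:E | y in Y] | x in X].

Definition dist_H (R : realType) (d : nat) (X Y : set 'rV[R]_d) : \bar R :=
  maxe (p_H X Y) (p_H Y X).

Definition generalized_tangent_by (R : realType) (d : nat)
    (F Fhat : set 'rV[R]_d) (T : nat -> 'rV[R]_d -> 'rV[R]_d)
    (a b : nat -> R) : Prop :=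
  [/\ forall k, 0 < a k /\ a k <= b k,
      forall k (x y : 'rV[R]_d),
        a k * enorm (x - y) <= enorm (T k x - T k y) /\
        enorm (T k x - T k y) <= b k * enorm (x - y),
      (ereal_sup [set (b k / a k)%:E | k in [set: nat]] < +oo)%E,
      ereal_sup [set (b k)%:E | k in [set: nat]] = +oo%E &
      dist_H (T k @` F `&` @unit_cube R d) Fhat @[k --> \oo] --> 0%:E].

Definition generalized_fast_tangent_by (R : realType) (d : nat)
    (F Fhat : set 'rV[R]_d) (T : nat -> 'rV[R]_d -> 'rV[R]_d)
    (a b : nat -> R) : Prop :=
  generalized_tangent_by F Fhat T a b /\
  exists C eps : R, [/\ 0 < C, 0 < eps &
    forall k, (dist_H (T k @` F `&` @unit_cube R d) Fhat
                 <= (C * b k `^ (- eps))%:E)%E].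

(* Main.v *)
(* At scale [b k] the map [T k] identifies [F], on balls of radius [rho / b k],
   with [Fhat] on balls of radius [rho], up to an error [eta ~ b k ^ -eps].
   Hence covering numbers of [Fhat] at scales [r >= eta] in such balls are
   comparable with those of [F] at scale [r / b k] in balls of radius
   [rho / b k].  Dividing by [b k] makes this pair of radii satisfy the gap
   [r / b k <= (rho / b k) ^ (1 + delta')] required by the quasi dimensions.
   For the box dimensions one takes [rho ~ 1] and [r ~ eta], and
   [eta / b k ~ (1 / b k) ^ (1 + eps)] leaves room for any [delta' < eps].  For
   the quasi dimensions of [Fhat], [r <= rho ^ (1 + delta)] are given and one
   picks [k] with [eta ~ r], which exists when [b] grows at most geometrically;
   the gap then holds for [delta'] small in terms of [delta] and [eps]. *)
Require Import Defs.
From HB Require Import structures.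
From mathcomp Require Import all_boot all_order all_algebra.
From mathcomp Require Import all_classical all_reals all_analysis.
From mathcomp Require Import ring lra.

Set Implicit Arguments.
Unset Strict Implicit.
Unset Printing Implicit Defensive.

Import Order.TTheory GRing.Theory Num.Theory.
Import numFieldNormedType.Exports.

Local Open Scope classical_set_scope.
Local Open Scope ring_scope.

(* MathComp-Analysis has another [covered_by], which shadows the one of Defs. *)
Local Notation covered_by := Defs.covered_by.

(** * The Euclidean norm on row vectors *)

Lemma sum_sqr_ge0 (R : realType) (d : nat) (f : 'I_d -> R) :
  0 <= \sum_(i < d) f i ^+ 2.
Proof. by apply: sumr_ge0 => i _; exact: sqr_ge0. Qed.

(** The sum of the squares [(s * f i + t * g i) ^+ 2] is nonnegative; at [s = - p], [t = a] it
    equals [a * (a * c - p ^+ 2)]. If [a = 0], every [f i] vanishes and so does [p]. *)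
Lemma cauchy_schwarz (R : realType) (d : nat) (f g : 'I_d -> R) :
  (\sum_(i < d) f i * g i) ^+ 2
    <= (\sum_(i < d) f i ^+ 2) * (\sum_(i < d) g i ^+ 2).
Proof.
set p := \sum_i _ * _; set a := \sum_i f i ^+ 2; set c := \sum_i g i ^+ 2.
have a0 : 0 <= a := @sum_sqr_ge0 R d f.
have c0 : 0 <= c := @sum_sqr_ge0 R d g.
have quad s t : 0 <= s ^+ 2 * a + 2 * (s * t) * p + t ^+ 2 * c.
  suff -> : s ^+ 2 * a + 2 * (s * t) * p + t ^+ 2 * c =
            \sum_(i < d) (s * f i + t * g i) ^+ 2 by exact: sum_sqr_ge0.
  rewrite !mulr_sumr -!big_split /=; apply: eq_bigr => i _; ring.
have [a00|a_neq0] := eqVneq a 0; last first.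
  have := quad (- p) a; have : 0 < a by rewrite lt0r a_neq0.
  move=> a_gt0; suff -> : (- p) ^+ 2 * a + 2 * (- p * a) * p + a ^+ 2 * c
      = a * (a * c - p ^+ 2) by rewrite pmulr_rge0 // subr_ge0.
  ring.
suff -> : p = 0 by rewrite expr0n mulr_ge0.
apply: big1 => i _.
have /(_ i isT) := psumr_eq0P (fun i _ => sqr_ge0 (f i)) a00.
by move=> /eqP; rewrite sqrf_eq0 => /eqP ->; rewrite mul0r.
Qed.

Lemma enorm_ge0 (R : realType) (d : nat) (x : 'rV[R]_d) : 0 <= enorm x.
Proof. exact: sqrtr_ge0. Qed.

Lemma enormN (R : realType) (d : nat) (x : 'rV[R]_d) : enorm (- x) = enorm x.
Proof.
by rewrite /enorm; congr Num.sqrt; apply: eq_bigr => i _; rewrite mxE sqrrN.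
Qed.

Lemma enormB (R : realType) (d : nat) (x y : 'rV[R]_d) :
  enorm (x - y) = enorm (y - x).
Proof. by rewrite -enormN opprB. Qed.

Lemma enorm_triangle (R : realType) (d : nat) (x y : 'rV[R]_d) :
  enorm (x + y) <= enorm x + enorm y.
Proof.
rewrite -(@ler_pXn2r _ 2) ?nnegrE ?addr_ge0 ?enorm_ge0 //.
rewrite sqrrD /enorm !sqr_sqrtr ?sum_sqr_ge0 //.
set p := \sum_(i < d) x ord0 i * y ord0 i.
have -> : \sum_(i < d) (x + y) ord0 i ^+ 2 =
    \sum_(i < d) x ord0 i ^+ 2 + p *+ 2 + \sum_(i < d) y ord0 i ^+ 2.
  by rewrite -sumrMnl -!big_split /=; apply: eq_bigr => i _; rewrite mxE sqrrD.
rewrite lerD2r lerD2l lerMn2r //=.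
apply: le_trans (ler_norm p) _.
by rewrite -sqrtr_sqr -sqrtrM ?sum_sqr_ge0 // ler_wsqrtr // cauchy_schwarz.
Qed.

Lemma enorm_dist_triangle (R : realType) (d : nat) (y x z : 'rV[R]_d) :
  enorm (x - z) <= enorm (x - y) + enorm (y - z).
Proof. by rewrite -[x - z](subrKA y); exact: enorm_triangle. Qed.

Lemma normr_le_enorm (R : realType) (d : nat) (x : 'rV[R]_d) (i : 'I_d) :
  `|x ord0 i| <= enorm x.
Proof.
rewrite -sqrtr_sqr ler_wsqrtr // (bigD1 i) //= lerDl.
by apply: sumr_ge0 => j _; exact: sqr_ge0.
Qed.

(** The factor [d.+1] is cruder than the square root of [d], but it is positive even for [d = 0] and
    can be divided by. *)
Lemma enorm_le (R : realType) (d : nat) (x : 'rV[R]_d) (m : R) :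
  0 <= m -> (forall i, `|x ord0 i| <= m) -> enorm x <= d.+1%:R * m.
Proof.
move=> m0 xm; rewrite -(@ler_pXn2r _ 2) ?nnegrE ?enorm_ge0 ?mulr_ge0 //.
rewrite sqr_sqrtr ?sum_sqr_ge0 //.
apply: (@le_trans _ _ (\sum_(i < d) m ^+ 2)).
  apply: ler_sum => i _; rewrite -[leLHS]real_normK ?num_real //.
  by rewrite ler_pXn2r ?nnegrE.
rewrite sumr_const card_ord -[leLHS]mulr_natl exprMn ler_wpM2r ?sqr_ge0 //.
by rewrite -natrX ler_nat (leq_trans (leqnSn d)) // expnS expn1 leq_pmulr.
Qed.

(** * Covering numbers and transfer of covers *)

(** One finite cover rules out the default value of [xget]: the least size of a cover exists and is
    attained. *)
Lemma covered_by_covering_number (R : realType) (d : nat) (r : R)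
    (A : set 'rV[R]_d) :
  (exists n, covered_by r A n) -> covered_by r A (covering_number r A).
Proof.
move=> [n An]; rewrite /covering_number.
set P := [set _ | _]; suff [] : P (xget 0%N P) by [].
apply: xgetPex.
have ex : exists n, `[< covered_by r A n >] by exists n; apply/asboolP.
exists (ex_minn ex); case: ex_minnP => m /asboolP Am m_min; split=> // k Ak.
by apply: m_min; apply/asboolP.
Qed.

Lemma covering_number_le (R : realType) (d : nat) (r : R) (A : set 'rV[R]_d)
    (n : nat) :
  covered_by r A n -> (covering_number r A <= n)%N.
Proof.
move=> An; rewrite /covering_number; case: xgetP => // m _ [_]; exact.
Qed.

Lemma covered_by_sub (R : realType) (d : nat) (r : R) (A B : set 'rV[R]_d)
    (n : nat) : A `<=` B -> covered_by r B n -> covered_by r A n.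
Proof. by move=> AB [c Bc]; exists c; exact: subset_trans AB Bc. Qed.

Lemma compact_covered_by (R : realType) (d : nat) (A : set 'rV[R]_d) (r : R) :
  compact A -> 0 < r -> exists n, covered_by r A n.
Proof.
(* Compactness provides sup-norm balls; one of radius [e] lies in the Euclidean ball of radius
   [r]. *)
move=> cA r0; set e := r / d.+1%:R.
have e0 : 0 < e by rewrite divr_gt0.
have cov : A `<=` cover [set: 'rV[R]_d] (fun c => ball c e).
  by move=> x _; exists x => //; exact: ballxx.
move: cA; rewrite compact_cover => cA.
have [|D _ AD] := cA _ _ _ _ cov; first by move=> c _; exact: ball_open.
pose s := finmap.enum_fset D.
exists (size s), (fun i => nth 0 s i).
move=> x /AD[c /= cD cx].
have cs : c \in s by [].
have iD : (index c s < size s)%N by rewrite index_mem.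
exists (Ordinal iD) => //=; rewrite nth_index // /eball /=.
have -> : r = d.+1%:R * e by rewrite /e mulrC divfK // pnatr_eq0.
apply: enorm_le; first exact: ltW.
by move=> i; have := cx.2 ord0 i; rewrite /ball /= !mxE => /ltW.
Qed.

(* Read [g x y] as "[y] approximates [x]". *)
Lemma covered_by_rel (R : realType) (d : nat) (A B : set 'rV[R]_d) (r s : R)
    (g : 'rV[R]_d -> 'rV[R]_d -> Prop) (n : nat) :
    (forall x, A x -> exists2 y, B y & g x y) ->
    (forall c, exists c', forall x y, A x -> B y -> g x y ->
       eball c s y -> eball c' r x) ->
  covered_by s B n -> covered_by r A n.
Proof.
move=> AB sr [c Bc]; have /choice[c' cc'] := fun i => sr (c i).
exists c' => x Ax; have [y By gxy] := AB x Ax.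
by have [i _ ciy] := Bc y By; exists i => //; exact: cc' gxy ciy.
Qed.

(** * Comparing covering numbers of [F] and [E] through one map *)

(** What is kept of one map of a fast tangent: [L] bounds the ratio of its Lipschitz constants, and
    [eta] the Hausdorff distance, with its infima replaced by actual nearby points. *)
Definition scale_approx (R : realType) (d : nat) (F E : set 'rV[R]_d)
    (L b eta : R) : Prop :=
  exists T : 'rV[R]_d -> 'rV[R]_d,
    [/\ forall x y, b / L * enorm (x - y) <= enorm (T x - T y) /\
                    enorm (T x - T y) <= b * enorm (x - y),
        forall x, E x -> exists2 z, F z & enorm (x - T z) <= eta &
        forall z, F z -> @unit_cube R d (T z) ->
          exists2 x, E x & enorm (T z - x) <= eta].

(** Covers are pushed forward: [T] maps a ball of radius [2^-1 * r / b] into one of radius [r / 2],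
    and the error [eta <= r / 2] fills the rest. Points of [F] approximating the ball about [x] have
    images within [rho + 2 * eta <= 2 * rho] of [T z]. *)
Lemma scale_approx_covering_le (R : realType) (d : nat) (F E : set 'rV[R]_d)
    (L b eta r rho : R) (x : 'rV[R]_d) :
  compact F -> 0 < L -> 0 < b -> scale_approx F E L b eta ->
  0 < r -> 2 * eta <= r -> r <= rho -> E x ->
  exists2 z, F z &
    (covering_number r (E `&` eball x rho)
       <= covering_number (2^-1 * r / b) (F `&` eball z (2 * L * rho / b)))%N.
Proof.
move=> cF L0 b0 [T [biL ET _]] r0 eta_r r_rho Ex.
have [z Fz xz] := ET x Ex; exists z => //.
set s := 2^-1 * r / b.
have s0 : 0 < s by rewrite divr_gt0 // mulr_gt0.
have bs : b * s = 2^-1 * r by rewrite /s mulrC divfK ?gt_eqF.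
apply: covering_number_le.
apply: (@covered_by_rel R d _ (F `&` eball z (2 * L * rho / b)) r s
  (fun y w => enorm (y - T w) <= eta)).
- move=> y [Ey xy]; have [w Fw yw] := ET y Ey; exists w => //; split=> //.
  rewrite /eball /=.
  have -> : 2 * L * rho / b = (2 * rho) / (b / L).
    by field; rewrite !gt_eqF.
  rewrite ler_pdivlMr ?divr_gt0 // mulrC.
  apply: le_trans (biL z w).1 _.
  have := enorm_dist_triangle x (T z) (T w).
  have := enorm_dist_triangle y x (T w).
  rewrite (enormB (T z) x); move: xy; rewrite /eball /=; lra.
- move=> c; exists (T c) => y w _ _ yw; rewrite /eball /= => cw.
  have := enorm_dist_triangle (T w) (T c) y; rewrite (enormB (T w) y).
  have := (biL c w).2; have : b * enorm (c - w) <= b * s by rewrite ler_pM2l.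
  lra.
- apply: covered_by_covering_number.
  have [n Fn] := compact_covered_by cF s0; exists n.
  by apply: covered_by_sub Fn => w [].
Qed.

(** Covers are pulled back. Images of points of [F] near [z] stay in the ball about [y], hence in
    the cube, which is where they have approximants in [E]. Two images with approximants in the same
    ball are at most [2 * r + 2 * eta <= 4 * r] apart. *)
Lemma scale_approx_covering_ge (R : realType) (d : nat) (F E : set 'rV[R]_d)
    (L b eta r rho theta : R) (x y : 'rV[R]_d) :
  compact E -> 0 < L -> 0 < b -> scale_approx F E L b eta ->
  0 < r -> eta <= r -> 2 * eta <= theta -> 2 * eta <= rho -> E y ->
  eball y theta `<=` eball x (rho / 2) `&` @unit_cube R d ->
  exists2 z, F z &
    (covering_number (4 * L * r / b) (F `&` eball z (theta / 2 / b))
       <= covering_number r (E `&` eball x rho))%N.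
Proof.
move=> cE L0 b0 [T [biL ET TE]] r0 eta_r eta_th eta_rho Ey ysub.
have [z Fz yz] := ET y Ey; exists z => //.
have near_y w : eball z (theta / 2 / b) w -> eball y theta (T w).
  rewrite /eball /= ler_pdivlMr // mulrC => zw.
  have := enorm_dist_triangle (T z) y (T w); have := (biL z w).2; lra.
apply: covering_number_le.
apply: (@covered_by_rel R d _ (E `&` eball x rho) _ r
  (fun w v => enorm (T w - v) <= eta)).
- move=> w [Fw /near_y /ysub[xw Qw]].
  have [v Ev wv] := TE w Fw Qw; exists v => //; split=> //; rewrite /eball /=.
  have := enorm_dist_triangle (T w) x v; move: xw; rewrite /eball /=; lra.
- move=> c.
  (* [T] is not known to be onto, so [c] need not have a preimage: the ball is
     recentred at a point of [F], at the cost of doubling its radius. *)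
  have [[w0 [v0 [wv0 cv0]]]|no] :=
      pselect (exists w v, enorm (T w - v) <= eta /\ eball c r v); last first.
    by exists c => w v _ _ wv cv; case: no; exists w, v.
  exists w0 => w v _ _ wv; rewrite /eball /= => cv.
  have -> : 4 * L * r / b = (4 * r) / (b / L) by field; rewrite !gt_eqF.
  rewrite ler_pdivlMr ?divr_gt0 // mulrC; apply: le_trans (biL w0 w).1 _.
  have := enorm_dist_triangle v0 (T w0) (T w).
  have := enorm_dist_triangle c v0 (T w).
  have := enorm_dist_triangle v c (T w).
  rewrite (enormB v0 c) (enormB v (T w)); move: cv0; rewrite /eball /=; lra.
- apply: covered_by_covering_number.
  have [n En] := compact_covered_by cE r0; exists n.
  by apply: covered_by_sub En => v [].
Qed.

(** * Gaps between radii, and monotonicity in [delta] *)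

(** Logarithms make the gap condition linear. For [rho > 1] the power with exponent [1 + delta > 1]
    would exceed [rho]. *)
Lemma radii_ln (R : realType) (delta r rho : R) :
  0 < delta -> 0 < r -> r <= rho `^ (1 + delta) -> rho `^ (1 + delta) <= rho ->
  [/\ 0 < rho, rho <= 1 & ln r <= (1 + delta) * ln rho].
Proof.
move=> d0 r0 r_rho rho_le.
have rho0 : 0 < rho by exact: lt_le_trans r0 (le_trans r_rho rho_le).
have p0 : 0 < rho `^ (1 + delta) by exact: powR_gt0.
split=> //.
- rewrite leNgt; apply/negP => rho1; have := ln_gt0 rho1.
  move: rho_le; rewrite -ler_ln ?posrE // ln_powR => + l0.
  have := mulr_gt0 d0 l0; lra.
- by rewrite -ln_powR ler_ln ?posrE.
Qed.

Lemma ln_radii (R : realType) (delta r rho : R) :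
  0 <= delta -> 0 < r -> 0 < rho -> rho <= 1 ->
  ln r <= (1 + delta) * ln rho ->
  r <= rho `^ (1 + delta) /\ rho `^ (1 + delta) <= rho.
Proof.
move=> d0 r0 rho0 rho1 h; split.
  by rewrite -ler_ln ?posrE ?powR_gt0 // ln_powR.
by apply: ge1r_powR; [apply/andP|rewrite lerDl].
Qed.

Lemma radii_anti (R : realType) (delta delta' r rho : R) :
  0 < delta' -> delta' <= delta ->
  0 < r -> r <= rho `^ (1 + delta) -> rho `^ (1 + delta) <= rho ->
  r <= rho `^ (1 + delta') /\ rho `^ (1 + delta') <= rho.
Proof.
move=> d'0 dd r0 h1 h2.
have [rho0 rho1 h] := radii_ln (lt_le_trans d'0 dd) r0 h1 h2.
apply: ln_radii => //; first exact: ltW.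
apply: le_trans h _; rewrite ler_wnM2r ?ln_le0 //; lra.
Qed.

(** A larger [delta] tests fewer pairs of radii and so admits more exponents: [upper_h] is
    nonincreasing, and its limit at 0 from the right is a supremum. *)
Lemma quasi_assouad_dimE (R : realType) (d : nat) (E : set 'rV[R]_d) :
  quasi_assouad_dim E = ereal_sup [set upper_h E delta | delta in `]0, +oo[].
Proof.
apply/cvg_lim => //; apply: nonincreasing_at_right_cvge => // d1 d2.
rewrite !in_itv /= !andbT => d10 d20 d12; apply: ereal_inf_le_tmp.
apply: image_subset => alpha [a0 [b [c [b0 c0 H]]]]; split=> //.
exists b, c; split=> // r rho r0 h1 h2 rhob.
have [h3 h4] := radii_anti d10 d12 r0 h1 h2.
exact: H.
Qed.

(** More admissible exponents now raise a supremum, so [lower_h] is nondecreasing in [delta] and the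
    limit is an infimum. *)
Lemma quasi_lower_assouad_dimE (R : realType) (d : nat) (E : set 'rV[R]_d) :
  quasi_lower_assouad_dim E =
  ereal_inf [set lower_h E delta | delta in `]0, +oo[].
Proof.
apply/cvg_lim => //; apply: nondecreasing_at_right_cvge => // d1 d2.
rewrite !in_itv /= !andbT => d10 d20 d12; apply: ereal_sup_le.
apply: image_subset => alpha [a0 [b [c [b0 c0 H]]]]; split=> //.
exists b, c; split=> // r rho r0 h1 h2 rhob.
have [h3 h4] := radii_anti d10 d12 r0 h1 h2.
exact: H.
Qed.

Lemma upper_h_le_quasi_assouad_dim (R : realType) (d : nat)
    (E : set 'rV[R]_d) (delta : R) :
  0 < delta -> (upper_h E delta <= quasi_assouad_dim E)%E.
Proof.
move=> d0; rewrite quasi_assouad_dimE; apply: ereal_sup_ubound.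
by exists delta => //=; rewrite in_itv /= andbT.
Qed.

Lemma quasi_lower_assouad_dim_le_lower_h (R : realType) (d : nat)
    (E : set 'rV[R]_d) (delta : R) :
  0 < delta -> (quasi_lower_assouad_dim E <= lower_h E delta)%E.
Proof.
move=> d0; rewrite quasi_lower_assouad_dimE; apply: ereal_inf_lbound.
by exists delta => //=; rewrite in_itv /= andbT.
Qed.

(** * Bounding box dimensions along arbitrarily small radii *)

Lemma lower_box_dim_le (R : realType) (d : nat) (E : set 'rV[R]_d)
    (alpha c : R) :
  0 <= alpha -> 0 < c ->
  (forall e, 0 < e -> exists r, [/\ 0 < r, r < e &
     (covering_number r E)%:R <= c * (r^-1) `^ alpha]) ->
  (lower_box_dim E <= alpha%:E)%E.
Proof.
move=> a0 c0 H; rewrite /lower_box_dim /limf_einf leeNl /limf_esup.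
apply: le_ereal_inf_tmp => _ [V V0 <-].
apply/lee_addgt0Pr => tau tau0.
have [e /= e0 Ve] := V0.
(* The last bound on [r] gives [ln c <= tau * - ln r]: the constant [c] costs at most [tau] in the
   exponent. *)
pose m := Num.min e (Num.min 1 (expR (- (ln c / tau)))).
have [|r [r0 rm Hr]] := H m; first by rewrite !lt_min e0 ltr01 expR_gt0.
move: rm; rewrite !lt_min => /and3P[re r1 rc].
have l0 : 0 < - ln r by rewrite oppr_gt0 ln_lt0 // r0 r1.
have lc : ln c <= tau * - ln r.
  move: rc; rewrite -ltr_ln ?posrE ?expR_gt0 // expRK => /ltW.
  by rewrite lerNr ler_pdivrMr // mulrC.
apply: (@le_trans _ _ (- (ln (covering_number r E)%:R / - ln r)%:E + tau%:E)%E);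
  last first.
  rewrite leeD2r //; apply: ereal_sup_ubound; exists r => //.
  by apply: Ve => //=; rewrite sub0r normrN gtr0_norm.
rewrite -!EFinN -EFinD lee_fin lerNl opprD opprK.
suff : ln (covering_number r E)%:R / - ln r <= alpha + tau by lra.
rewrite ler_pdivrMr //.
(* A covering number 0 has logarithm 0 by convention, and the right-hand side is nonnegative. *)
have [->|n0] := eqVneq (covering_number r E) 0%N.
  by rewrite ln0 // mulr_ge0 ?addr_ge0 // ltW.
move: Hr; rewrite -ler_ln ?posrE ?ltr0n ?lt0n // ?mulr_gt0 ?powR_gt0 ?invr_gt0 //.
rewrite lnM ?posrE ?powR_gt0 ?invr_gt0 // ln_powR lnV ?posrE // => h.
by apply: le_trans h _; rewrite mulrDl; lra.
Qed.

Lemma upper_box_dim_ge (R : realType) (d : nat) (E : set 'rV[R]_d)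
    (alpha c : R) :
  0 < c ->
  (forall e, 0 < e -> exists r, [/\ 0 < r, r < e &
     c * (r^-1) `^ alpha <= (covering_number r E)%:R]) ->
  (alpha%:E <= upper_box_dim E)%E.
Proof.
move=> c0 H; rewrite /upper_box_dim /limf_esup.
apply: le_ereal_inf_tmp => _ [V V0 <-].
apply/lee_addgt0Pr => tau tau0.
have [e /= e0 Ve] := V0.
pose m := Num.min e (Num.min 1 (expR (ln c / tau))).
have [|r [r0 rm Hr]] := H m; first by rewrite !lt_min e0 ltr01 expR_gt0.
move: rm; rewrite !lt_min => /and3P[re r1 rc].
have l0 : 0 < - ln r by rewrite oppr_gt0 ln_lt0 // r0 r1.
have lc : - ln c <= tau * - ln r.
  move: rc; rewrite -ltr_ln ?posrE ?expR_gt0 // expRK => /ltW.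
  by rewrite ler_pdivlMr // => h; rewrite mulrN lerN2 mulrC.
apply: (@le_trans _ _ ((ln (covering_number r E)%:R / - ln r)%:E + tau%:E)%E);
  last first.
  rewrite leeD2r //; apply: ereal_sup_ubound; exists r => //.
  by apply: Ve => //=; rewrite sub0r normrN gtr0_norm.
rewrite -EFinD lee_fin -lerBlDr ler_pdivlMr // mulrBl.
have p0 : 0 < c * r^-1 `^ alpha by rewrite mulr_gt0 ?powR_gt0 ?invr_gt0.
have N0 := lt_le_trans p0 Hr.
move: Hr; rewrite -ler_ln ?posrE //.
by rewrite lnM ?posrE ?powR_gt0 ?invr_gt0 // ln_powR lnV ?posrE //; lra.
Qed.

(** * Choosing the index [k] *)

(** The least [k] with [beta <= b k] works: it is not 0, and its predecessor lies below [beta]. *)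
Lemma first_scale_above (R : realType) (b : nat -> R) (C' beta : R) :
  (forall M, exists k, M <= b k) -> (forall k, b k.+1 <= C' * b k) ->
  0 <= C' -> b 0%N < beta -> exists k, beta <= b k /\ b k <= C' * beta.
Proof.
move=> unb grow C'0 b0; have ex : exists k, beta <= b k := unb beta.
case: (ex_minnP ex) => -[|k] hk mink; first by move: hk; rewrite leNgt b0.
exists k.+1; split=> //; apply: le_trans (grow k) _; rewrite ler_wpM2l //.
rewrite leNgt; apply/negP => /ltW /mink; by rewrite ltnn.
Qed.

(** The order of quantifiers matters: [delta'] precedes [q], [K], [kappa] and [beta], because [beta]
    will come with each exponent admissible for [F] at gap [delta']. *)
Lemma scale_of_radii (R : realType) (b : nat -> R) (C' eps delta : R) :
  (forall k, 0 < b k) -> (forall M, exists k, M <= b k) ->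
  (forall k, b k.+1 <= C' * b k) -> 0 < eps -> 0 < delta ->
  exists2 delta', 0 < delta' &
  forall q K kappa beta : R, 0 < q -> 0 < K -> 0 < kappa -> 0 < beta ->
  exists2 e, 0 < e &
  forall r rho : R, 0 < r -> 0 < rho -> rho <= e ->
    ln r <= (1 + delta) * ln rho ->
  exists k, [/\ q * b k `^ (- eps) <= r, kappa * rho / b k <= beta,
    kappa * rho / b k <= 1 &
    ln (K * r / b k) <= (1 + delta') * ln (kappa * rho / b k)].
Proof.
move=> b_gt0 unb grow eps0 delta0.
have C'0 : 0 < C'.
  by have := lt_le_trans (b_gt0 1%N) (grow 0%N); rewrite pmulr_lgt0.
pose j := (1 + delta)^-1; pose i := eps^-1.
have j0 : 0 < j by rewrite invr_gt0; lra.
have i0 : 0 < i by rewrite invr_gt0.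
have ei : eps * i = 1 by rewrite /i divff ?gt_eqF.
have dj : (1 + delta) * j = 1 by rewrite /j divff // gt_eqF //; lra.
(* With [b k ~ r^(-i)] and [r <= rho^(1 + delta)], the last inequality holds
   for small [r] once [(1 + delta') * j + delta' * i < 1]; [delta'] is chosen to
   make the left-hand side equal to [1 - mu]. *)
pose mu := delta * j / 2.
have mu0 : 0 < mu by rewrite divr_gt0 // mulr_gt0.
pose delta' := mu / (j + i).
have ij0 : 0 < j + i by rewrite addr_gt0.
exists delta' => [|q K kappa beta q0 K0 kappa0 beta0]; first by rewrite divr_gt0.
have delta'0 : 0 < delta' by rewrite divr_gt0.
have exponents : (1 + delta') * j + delta' * i = 1 - mu.
  have : delta' * (j + i) = mu by rewrite /delta' divfK ?gt_eqF.
  have : mu = delta * j / 2 by [].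
  lra.
(* [cst] collects the constants of the last inequality. The entries of [M] ensure in turn
   [rho <= 1], a scaled radius below [beta] and 1, [cst <= mu * - ln r], and that [b 0] lies below
   the threshold for [b k]. *)
pose m0 := Num.min (ln beta) 0.
pose cst := ln K - (1 + delta') * ln kappa + delta' * (ln C' + ln q * i).
pose M := Num.max 0 (Num.max (ln kappa - ln q * i - m0)
  (Num.max (cst / mu) (eps * ln (b 0%N) - ln q + 1))).
exists (expR (- M)) => [|r rho r0 rho0 rhoM r_rho]; first exact: expR_gt0.
have : M <= - ln rho.
  by move: rhoM; rewrite -ler_ln ?posrE ?expR_gt0 // expRK lerNr.
rewrite !ge_max => /and4P[P0 P1 P2 P3].
set P := - ln rho in P0 P1 P2 P3; set x := - ln r.
have xP : (1 + delta) * P <= x by rewrite /P /x mulrN lerN2.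
have Px : P <= x * j.
  have : j * ((1 + delta) * P) <= j * x by rewrite ler_pM2l.
  by rewrite mulrA [j * (1 + _)]mulrC dj mul1r mulrC.
have Pltx : P <= x by have := mulr_ge0 (ltW delta0) P0; lra.
(* The threshold is [(q / r) ^ (1 / eps)], the value of [b k] at which [q * b k ^ -eps] equals
   [r]. *)
have [|k [hk1 hk2]] :=
    @first_scale_above R b C' (expR ((ln q + x) * i)) unb grow (ltW C'0).
  rewrite -ltr_ln ?posrE ?expR_gt0 // expRK ltr_pdivlMr // mulrC; lra.
exists k.
have bk := b_gt0 k.
set B := ln (b k).
have B1 : (ln q + x) * i <= B.
  by move: hk1; rewrite -ler_ln ?posrE ?expR_gt0 // expRK.
have B2 : B <= ln C' + (ln q + x) * i.
  by move: hk2; rewrite -ler_ln ?posrE ?mulr_gt0 ?expR_gt0 // lnM ?posrE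
    ?expR_gt0 // expRK.
have lnkr : ln (kappa * rho / b k) = ln kappa - P - B.
  by rewrite ln_div ?posrE ?mulr_gt0 // lnM ?posrE // /P opprK.
have small : ln (kappa * rho / b k) <= m0.
  have xi0 : 0 <= x * i by rewrite mulr_ge0 ?(ltW i0) //; lra.
  rewrite lnkr; lra.
have kr0 : 0 < kappa * rho / b k by rewrite divr_gt0 // mulr_gt0.
move: (small); rewrite {1}/m0 le_min => /andP[sm1 sm2].
split.
- rewrite -ler_ln ?posrE ?mulr_gt0 ?powR_gt0 // lnM ?posrE ?powR_gt0 //.
  rewrite ln_powR -/B mulNr.
  have : eps * ((ln q + x) * i) <= eps * B by rewrite ler_pM2l.
  by rewrite mulrCA ei mulr1 /x; lra.
- by rewrite -ler_ln ?posrE.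
- by rewrite -ler_ln ?posrE // ln1.
- rewrite lnkr ln_div ?posrE ?mulr_gt0 // lnM ?posrE // -/B.
  have -> : ln r = - x by rewrite /x opprK.
  have h1 : (1 + delta') * P <= (1 + delta') * (x * j).
    by rewrite ler_pM2l //; lra.
  have h2 : delta' * B <= delta' * (ln C' + (ln q + x) * i).
    by rewrite ler_pM2l.
  have h3 : cst <= mu * x.
    by rewrite -ler_pdivrMl // mulrC; exact: le_trans P2 Pltx.
  have h4 : ((1 + delta') * j + delta' * i) * x = (1 - mu) * x.
    by rewrite exponents.
  move: h3; rewrite /cst; lra.
Qed.

(** The small radius is tied to [b k], so any [k] with [b k] large works: the left side of the last
    inequality falls like [- (1 + eps) * ln (b k)], the right side only like
    [- (1 + eps / 2) * ln (b k)], and the difference absorbs the constants. *)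
Lemma large_scale (R : realType) (b : nat -> R) (eps q K kappa beta e : R) :
  (forall k, 0 < b k) -> (forall M, exists k, M <= b k) ->
  0 < eps -> 0 < q -> 0 < K -> 0 < kappa -> 0 < beta -> 0 < e ->
  exists k, [/\ q * b k `^ (- eps) < e, kappa / b k <= beta,
    kappa / b k <= 1 &
    ln (K * (q * b k `^ (- eps)) / b k) <= (1 + eps / 2) * ln (kappa / b k)].
Proof.
move=> b_gt0 unb eps0 q0 K0 kappa0 beta0 e0.
pose m0 := Num.min (ln beta) 0.
pose M := Num.max (ln kappa - m0) (Num.max ((ln q - ln e + 1) / eps)
  ((ln K + ln q - (1 + eps / 2) * ln kappa) / (eps / 2))).
have [k hk] := unb (expR M); exists k; have bk := b_gt0 k.
have e20 : 0 < eps / 2 by rewrite divr_gt0.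
have : M <= ln (b k) by rewrite -[M]expRK ler_ln ?posrE ?expR_gt0.
rewrite !ge_max => /and3P[M1]; rewrite ler_pdivrMr // => M2.
rewrite ler_pdivrMr // => M3.
have sm : ln (kappa / b k) <= m0 by rewrite ln_div ?posrE //; lra.
have kb0 : 0 < kappa / b k by rewrite divr_gt0.
have p0 : 0 < b k `^ (- eps) by rewrite powR_gt0.
move: sm; rewrite /m0 le_min => /andP[sm1 sm2].
split.
- rewrite -ltr_ln ?posrE ?mulr_gt0 // lnM ?posrE // ln_powR mulNr; lra.
- by rewrite -ler_ln ?posrE.
- by rewrite -ler_ln ?posrE // ln1.
- rewrite !ln_div ?posrE ?mulr_gt0 // lnM ?posrE ?mulr_gt0 // lnM ?posrE //.
  rewrite ln_powR mulNr; lra.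
Qed.

(** * The four dimension inequalities, for scale approximations *)

Lemma unit_cube_dist (R : realType) (d : nat) (x y : 'rV[R]_d) :
  @unit_cube R d x -> @unit_cube R d y -> enorm (x - y) <= d.+1%:R.
Proof.
move=> Qx Qy; rewrite -[leRHS]mulr1; apply: enorm_le => // i.
rewrite !mxE ler_norml; have /andP[? ?] := Qx i; have /andP[? ?] := Qy i.
by apply/andP; split; lra.
Qed.

Lemma lower_box_dim_le_upper_h (R : realType) (d : nat) (F E : set 'rV[R]_d)
    (L C eps : R) (b : nat -> R) :
  compact F -> E !=set0 -> E `<=` @unit_cube R d -> 0 < L -> 0 < C ->
  0 < eps -> (forall k, 0 < b k) -> (forall M, exists k, M <= b k) ->
  (forall k, scale_approx F E L (b k) (C * b k `^ (- eps))) ->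
  (lower_box_dim E <= upper_h F (eps / 2))%E.
Proof.
move=> cF [x Ex] EQ L0 C0 eps0 b_gt0 unb approx.
apply: le_ereal_inf_tmp => _ [alpha [a0 [beta [c [beta0 c0 H]]]] <-].
(* A ball of radius [D] about a point of the cube contains the cube, so covering numbers of [E]
   inside it are global. *)
pose D : R := d.+1%:R; have D0 : 0 < D by rewrite ltr0n.
have cube : E `&` eball x D = E.
  apply/seteqP; split=> [y []|y Ey] //; split=> //.
  by apply: unit_cube_dist; apply: EQ.
have C20 : 0 < 2 * C by rewrite mulr_gt0.
have LD0 : 0 < 2 * L * D by rewrite !mulr_gt0.
(* [4 * L * D / r] is the ratio of the radii used in [F]. *)
apply: (@lower_box_dim_le R d E alpha (c * (4 * L * D) `^ alpha)) => //.
  by rewrite mulr_gt0 // powR_gt0 // !mulr_gt0.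
move=> e e0.
have half0 : 0 < 2^-1 :> R by rewrite invr_gt0.
have eD0 : 0 < Num.min e D by rewrite lt_min e0.
have [k [re kb k1 kln]] :=
  large_scale b_gt0 unb eps0 C20 half0 LD0 beta0 eD0.
have bk := b_gt0 k.
set r := 2 * C * b k `^ (- eps) in re kln.
have r0 : 0 < r by rewrite mulr_gt0 // powR_gt0.
move: re; rewrite lt_min => /andP[re rD].
exists r; split=> //.
have [|z Fz hN] := scale_approx_covering_le cF L0 bk (approx k) r0 _ (ltW rD) Ex.
  by rewrite /r mulrA.
rewrite -{1}cube; move: hN; rewrite -(ler_nat R) => /le_trans; apply.
have rb0 : 0 < 2^-1 * r / b k by rewrite divr_gt0 // mulr_gt0.
have [h1 h2] := ln_radii (ltW (divr_gt0 eps0 (ltr0n R 2))) rb0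
  (divr_gt0 LD0 bk) k1 kln.
apply: le_trans (H _ _ rb0 h1 h2 kb z Fz) _.
rewrite -[leRHS]mulrA -powRM ?invr_ge0 ?(ltW r0) ?mulr_ge0 ?(ltW L0) ?(ltW D0) //.
suff -> : 2 * L * D / b k / (2^-1 * r / b k) = 4 * L * D * r^-1 by [].
by field; rewrite !gt_eqF.
Qed.

Lemma lower_h_le_upper_box_dim (R : realType) (d : nat) (F E : set 'rV[R]_d)
    (L C eps theta : R) (b : nat -> R) (x : 'rV[R]_d) :
  compact E -> E `<=` @unit_cube R d -> E x -> 0 < theta ->
  eball x theta `<=` @unit_cube R d -> 0 < L -> 0 < C ->
  0 < eps -> (forall k, 0 < b k) -> (forall M, exists k, M <= b k) ->
  (forall k, scale_approx F E L (b k) (C * b k `^ (- eps))) ->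
  (lower_h F (eps / 2) <= upper_box_dim E)%E.
Proof.
move=> cE EQ Ex th0 xQ L0 C0 eps0 b_gt0 unb approx.
apply: ge_ereal_sup => _ [alpha [a0 [beta [c [beta0 c0 H]]]] <-].
pose D : R := d.+1%:R; have D0 : 0 < D by rewrite ltr0n.
(* The radius is [2 * D] because the inner ball must fit into the ball of half that radius. *)
have cube : E `&` eball x (2 * D) = E.
  apply/seteqP; split=> [y []|y Ey] //; split=> //.
  have := unit_cube_dist (EQ _ Ex) (EQ _ Ey).
  by rewrite /eball /=; move: D0; rewrite /D; lra.
have xsub : eball x theta `<=` eball x (2 * D / 2) `&` @unit_cube R d.
  move=> y xy; split; last exact: xQ.
  have := unit_cube_dist (EQ _ Ex) (xQ _ xy); rewrite /eball /= -/D; lra.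
have th20 : 0 < theta / 2 by rewrite divr_gt0.
have L40 : 0 < 4 * L by rewrite mulr_gt0.
apply: (@upper_box_dim_ge R d E alpha (c * (theta / (8 * L)) `^ alpha)).
  by rewrite mulr_gt0 // powR_gt0 // divr_gt0 // mulr_gt0.
move=> e e0.
have e'0 : 0 < Num.min e (Num.min (theta / 2) D) by rewrite !lt_min e0 th20.
have [k [re kb k1 kln]] := large_scale b_gt0 unb eps0 C0 L40 th20 beta0 e'0.
have bk := b_gt0 k; have apk := approx k.
set r := C * b k `^ (- eps) in re kln apk.
have r0 : 0 < r by rewrite mulr_gt0 // powR_gt0.
move: re; rewrite !lt_min => /and3P[re rth rD].
exists r; split=> //.
have [||z Fz hN] := scale_approx_covering_ge cE L0 bk apk r0 (lexx r) _ _ Ex xsub.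
- by lra.
- by lra.
move: hN; rewrite cube -(ler_nat R); apply: le_trans.
have rb0 : 0 < 4 * L * r / b k by rewrite divr_gt0 // mulr_gt0.
have [h1 h2] := ln_radii (ltW (divr_gt0 eps0 (ltr0n R 2))) rb0
  (divr_gt0 th20 bk) k1 kln.
apply: le_trans (H _ _ rb0 h1 h2 kb z Fz).
rewrite -[leLHS]mulrA -powRM ?invr_ge0 ?(ltW r0) ?divr_ge0 ?(ltW th0) //;
  last by rewrite mulr_ge0 // ltW.
suff -> : theta / 2 / b k / (4 * L * r / b k) = theta / (8 * L) * r^-1 by [].
by field; rewrite !gt_eqF.
Qed.

(** Each exponent admissible for [F] at gap [delta'] is admissible for [E] at gap [delta], with [k]
    adapted to each pair of radii. The change of gap is harmless once the supremum over gaps is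
    taken. *)
Lemma upper_h_le_upper_h (R : realType) (d : nat) (F E : set 'rV[R]_d)
    (L C C' eps delta : R) (b : nat -> R) :
  compact F -> 0 < L -> 0 < C -> 0 < eps -> (forall k, 0 < b k) ->
  (forall M, exists k, M <= b k) -> (forall k, b k.+1 <= C' * b k) ->
  (forall k, scale_approx F E L (b k) (C * b k `^ (- eps))) -> 0 < delta ->
  exists2 delta', 0 < delta' & (upper_h E delta <= upper_h F delta')%E.
Proof.
move=> cF L0 C0 eps0 b_gt0 unb grow approx delta0.
have [delta' delta'0 scale] := scale_of_radii b_gt0 unb grow eps0 delta0.
exists delta' => //.
apply: le_ereal_inf_tmp => _ [alpha [a0 [beta [c [beta0 c0 H]]]] <-].
apply: ereal_inf_lbound; exists alpha => //; split=> //.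
have half0 : 0 < 2^-1 :> R by rewrite invr_gt0.
have C20 : 0 < 2 * C by rewrite mulr_gt0.
have L20 : 0 < 2 * L by rewrite mulr_gt0.
have [e e0 {}scale] := scale _ _ _ _ C20 half0 L20 beta0.
exists e, (c * (4 * L) `^ alpha); split=> //.
  by rewrite mulr_gt0 // powR_gt0 // mulr_gt0.
move=> r rho r0 r_rho rho_le rhoe x Ex.
have [rho0 rho1 lnr] := radii_ln delta0 r0 r_rho rho_le.
have [k [qr kb k1 kln]] := scale r rho r0 rho0 rhoe lnr.
have bk := b_gt0 k.
have [|z Fz hN] := scale_approx_covering_le cF L0 bk (approx k) r0 _
  (le_trans r_rho rho_le) Ex; first by rewrite mulrA.
move: hN; rewrite -(ler_nat R) => /le_trans; apply.
have rb0 : 0 < 2^-1 * r / b k by rewrite divr_gt0 // mulr_gt0.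
have Rb0 : 0 < 2 * L * rho / b k by rewrite divr_gt0 // mulr_gt0.
have [h1 h2] := ln_radii (ltW delta'0) rb0 Rb0 k1 kln.
apply: le_trans (H _ _ rb0 h1 h2 kb z Fz) _.
rewrite -[leRHS]mulrA -powRM ?divr_ge0 ?(ltW r0) ?(ltW rho0) ?mulr_ge0 ?(ltW L0) //.
suff -> : 2 * L * rho / b k / (2^-1 * r / b k) = 4 * L * (rho / r) by [].
by field; rewrite !gt_eqF.
Qed.

Lemma lower_h_le_lower_h (R : realType) (d : nat) (F E : set 'rV[R]_d)
    (L C C' eps delta theta : R) (b : nat -> R) :
  compact E -> 0 < L -> 0 < C -> 0 < eps -> (forall k, 0 < b k) ->
  (forall M, exists k, M <= b k) -> (forall k, b k.+1 <= C' * b k) ->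
  (forall k, scale_approx F E L (b k) (C * b k `^ (- eps))) -> 0 < delta ->
  0 < theta ->
  (forall r x, 0 < r -> r <= 1 -> E x -> exists y, E y /\
     eball y (r * theta) `<=` eball x r `&` @unit_cube R d) ->
  exists2 delta', 0 < delta' & (lower_h F delta' <= lower_h E delta)%E.
Proof.
move=> cE L0 C0 eps0 b_gt0 unb grow approx delta0 theta0 inner.
have [delta' delta'0 scale] := scale_of_radii b_gt0 unb grow eps0 delta0.
exists delta' => //.
apply: ge_ereal_sup => _ [alpha [a0 [beta [c [beta0 c0 H]]]] <-].
apply: ereal_sup_ubound; exists alpha => //; split=> //.
(* With [th <= 1], the single bound [4 * eta <= th * r] yields all three smallness conditions on
   [eta]: against [r], [rho] and the inner radius [rho / 2 * th]. *)
pose th := Num.min theta 1.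
have th0 : 0 < th by rewrite lt_min theta0 ltr01.
have th1 : th <= 1 by rewrite ge_min lexx orbT.
have th_theta : th <= theta by rewrite ge_min lexx.
have q0 : 0 < 4 / th * C by rewrite mulr_gt0 // divr_gt0.
have L40 : 0 < 4 * L by rewrite mulr_gt0.
have th40 : 0 < th / 4 by rewrite divr_gt0.
have [e e0 {}scale] := scale _ _ _ _ q0 L40 th40 beta0.
exists e, (c * (th / (16 * L)) `^ alpha); split=> //.
  by rewrite mulr_gt0 // powR_gt0 // divr_gt0 // mulr_gt0.
move=> r rho r0 r_rho rho_le rhoe x Ex.
have [rho0 rho1 lnr] := radii_ln delta0 r0 r_rho rho_le.
have rrho := le_trans r_rho rho_le.
have [k [qr kb k1 kln]] := scale r rho r0 rho0 rhoe lnr.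
have bk := b_gt0 k; have apk := approx k.
set eta := C * b k `^ (- eps) in apk.
have eta_r : 4 * eta <= th * r.
  have -> : 4 * eta = th * (4 / th * C * b k `^ (- eps)).
    by rewrite /eta; field; rewrite gt_eqF.
  by rewrite ler_pM2l.
have thr : th * r <= 1 * r by rewrite ler_pM2r.
have threta : th * r <= th * rho by rewrite ler_pM2l.
have [||y [Ey ysub]] := inner (rho / 2) x _ _ Ex; [lra|lra|].
have ysub' : eball y (rho / 2 * th) `<=` eball x (rho / 2) `&` @unit_cube R d.
  apply: subset_trans ysub => w; rewrite /eball /= => /le_trans; apply.
  by rewrite ler_pM2l // divr_gt0.
have [|||z Fz hN] := scale_approx_covering_ge cE L0 bk apk r0 _ _ _ Ey ysub';
  [lra|lra|lra|].
move: hN; rewrite -(ler_nat R); apply: le_trans.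
have thE : rho / 2 * th / 2 = th / 4 * rho by field.
rewrite thE.
have rb0 : 0 < 4 * L * r / b k by rewrite divr_gt0 // mulr_gt0.
have Rb0 : 0 < th / 4 * rho / b k by rewrite divr_gt0 // mulr_gt0.
have [h1 h2] := ln_radii (ltW delta'0) rb0 Rb0 k1 kln.
apply: le_trans (H _ _ rb0 h1 h2 kb z Fz).
rewrite -[leLHS]mulrA -powRM ?divr_ge0 ?(ltW r0) ?(ltW rho0) ?(ltW th0) //;
  last by rewrite mulr_ge0 // ltW.
suff -> : th / 4 * rho / b k / (4 * L * r / b k) = th / (16 * L) * (rho / r)
  by [].
by field; rewrite !gt_eqF.
Qed.

(** * From fast tangents to scale approximations, and conclusion *)

Lemma p_H_lt (R : realType) (d : nat) (X Y : set 'rV[R]_d) (eta : R)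
    (x : 'rV[R]_d) :
  (p_H X Y < eta%:E)%E -> X x -> exists2 y, Y y & enorm (x - y) <= eta.
Proof.
move=> XY Xx.
have : (ereal_inf [set (enorm (x - y))%:E | y in Y] < eta%:E)%E.
  by apply: le_lt_trans XY; apply: ereal_sup_ubound; exists x.
by move=> /ereal_inf_lt[_ [y Yy <-]]; rewrite lte_fin => /ltW; exists y.
Qed.

Lemma fast_tangent_scale_approx (R : realType) (d : nat) (F E : set 'rV[R]_d)
    (T : nat -> 'rV[R]_d -> 'rV[R]_d) (a b : nat -> R) :
  generalized_fast_tangent_by F E T a b ->
  [/\ forall k, 0 < b k, forall M, exists k, M <= b k &
    exists L C eps : R, [/\ 0 < L, 0 < C, 0 < eps &
      forall k, scale_approx F E L (b k) (C * b k `^ (- eps))]].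
Proof.
move=> [[ab biL ratio sup_b _] [C [eps [C0 eps0 fast]]]].
have b_gt0 k : 0 < b k by have [a0 /(lt_le_trans a0)] := ab k.
split=> //.
  move=> M.
  have : (M%:E < ereal_sup [set (b k)%:E | k in [set: nat]])%E.
    by rewrite sup_b ltry.
  move=> /ereal_sup_gt[_ [k _ <-]]; rewrite lte_fin => /ltW; by exists k.
have [L L0 ratioL] : exists2 L, 0 < L & forall k, b k / a k <= L.
  have ub k := ereal_sup_ubound
    (ex_intro2 _ _ k I erefl : [set (b k / a k)%:E | k in [set: nat]] _).
  (* The supremum is real: it is below [+oo] by assumption, and not [-oo] since it bounds
     [b 0 / a 0]. *)
  move: ratio ub; case: (ereal_sup _) => [L _ ub|//|_ ub].
  - exists L => [|k]; last by rewrite -lee_fin.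
    have := ub 0%N; rewrite lee_fin; apply: lt_le_trans.
    by rewrite divr_gt0 // (ab 0%N).1.
  - by have := ub 0%N; rewrite leeNy_eq.
(* Doubling [C] makes the distance bound strict, so that nearby points exist whether or not the
   infimum is attained. *)
exists L, (2 * C), eps; split=> //; first by rewrite mulr_gt0.
move=> k; have [a0 _] := ab k; have bk := b_gt0 k.
have C_lt : C * b k `^ (- eps) < 2 * C * b k `^ (- eps).
  have : 0 < C * b k `^ (- eps) by rewrite mulr_gt0 // powR_gt0.
  lra.
have : (dist_H (T k @` F `&` @unit_cube R d) E
         < (2 * C * b k `^ (- eps))%:E)%E.
  by apply: le_lt_trans (fast k) _; rewrite lte_fin.
rewrite /dist_H gt_max => /andP[TE ET].
exists (T k); split.
- move=> x y; have [h1 h2] := biL k x y; split=> //.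
  apply: le_trans h1; rewrite ler_wpM2r ?enorm_ge0 //.
  rewrite ler_pdivrMr // mulrC -ler_pdivrMr //; exact: ratioL.
- move=> x Ex; have [_ [[z Fz <-] _] xz] := p_H_lt ET Ex.
  by exists z.
- move=> z Fz Qz; apply: (p_H_lt TE); split=> //; by exists z.
Qed.

Lemma interior_eball (R : realType) (d : nat) (A : set 'rV[R]_d)
    (x : 'rV[R]_d) :
  interior A x -> exists2 theta, 0 < theta & eball x theta `<=` A.
Proof.
move=> /nbhs_ballP[e /= e0 xA]; exists (e / 2); first by rewrite divr_gt0.
move=> y xy; apply: xA; split=> // i j; rewrite ord1 /ball /=.
have := normr_le_enorm (x - y) j; rewrite !mxE => /le_lt_trans; apply.
by apply: le_lt_trans xy _; rewrite ltr_pdivrMr // ltr_pMr // ltr1n.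
Qed.

Theorem theorem6 (R : realType) (d : nat) (F Fhat : set 'rV[R]_d)
    (T : nat -> 'rV[R]_d -> 'rV[R]_d) (a b : nat -> R)
    (F_compact : compact F) (Fhat_compact : compact Fhat)
    (Fhat_nonempty : Fhat !=set0) (Fhat_cube : Fhat `<=` @unit_cube R d)
    (Fhat_tangent : generalized_fast_tangent_by F Fhat T a b) :
  ((lower_box_dim Fhat <= quasi_assouad_dim F)%E /\
   ((exists C' : R, forall k : nat, b k.+1 <= C' * b k) ->
    (quasi_assouad_dim Fhat <= quasi_assouad_dim F)%E)) /\
  ((exists x : 'rV[R]_d, Fhat x /\ interior (@unit_cube R d) x) ->
   (quasi_lower_assouad_dim F <= upper_box_dim Fhat)%E /\
   ((exists C' : R, forall k : nat, b k.+1 <= C' * b k) ->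
    (exists theta : R, 0 < theta /\
       forall (r : R) (x : 'rV[R]_d), 0 < r -> r <= 1 -> Fhat x ->
         exists y : 'rV[R]_d, Fhat y /\
           eball y (r * theta) `<=` eball x r `&` @unit_cube R d) ->
    (quasi_lower_assouad_dim F <= quasi_lower_assouad_dim Fhat)%E)).
Proof.
have [b_gt0 unb [L [C [eps [L0 C0 eps0 approx]]]]] :=
  fast_tangent_scale_approx Fhat_tangent.
have eps20 : 0 < eps / 2 by rewrite divr_gt0.
split=> [|[x [Ex /interior_eball[theta theta0 xQ]]]]; split.
- apply: le_trans (upper_h_le_quasi_assouad_dim F eps20).
  exact: lower_box_dim_le_upper_h approx.
(* Each gap [delta] for [Fhat] is matched with its own gap [delta'] for [F]. *)
- move=> [C' grow]; rewrite [leLHS]quasi_assouad_dimE.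
  apply: ge_ereal_sup => _ [delta /= + <-]; rewrite in_itv /= andbT => delta0.
  have [delta' delta'0 le_h] :=
    upper_h_le_upper_h F_compact L0 C0 eps0 b_gt0 unb grow approx delta0.
  exact: le_trans le_h (upper_h_le_quasi_assouad_dim F delta'0).
- apply: le_trans (quasi_lower_assouad_dim_le_lower_h F eps20) _.
  exact: lower_h_le_upper_box_dim Ex theta0 xQ L0 C0 eps0 b_gt0 unb approx.
- move=> [C' grow] [theta' [theta'0 inner]].
  rewrite [leRHS]quasi_lower_assouad_dimE.
  apply: le_ereal_inf_tmp => _ [delta /= + <-]; rewrite in_itv /= andbT.
  move=> delta0.
  have [delta' delta'0 le_h] := lower_h_le_lower_h Fhat_compact L0 C0 eps0
    b_gt0 unb grow approx delta0 theta'0 inner.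
  exact: le_trans (quasi_lower_assouad_dim_le_lower_h F delta'0) le_h.
Qed.
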